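(* Let $\Omega\subset\mathbb{C}^n$ be a hyperconvex domain, and suppose that $\mu$ is a positive Radon measure on $\Omega$ with the following minimality property: for every positive Radon measure $\nu$ with $\nu\le_{\mathrm{psh}}\mu$, there is $k_\nu\in[0,1]$ such that $\nu=k_\nu\mu$. Then $\mu(\Omega)=0$.
   Context: Hyperconvex domains are taken to be bounded. For positive Radon measures $\nu,\mu$ supported on $\bar\Omega$, write $\nu\le_{\mathrm{psh}}\mu$ if $\int u\,d\nu\ge\int u\,d\mu$ for all $u\in\mathcal{E}_0(\Omega)$, where $\mathcal{E}_0(\Omega)$ is Cegrell's class of bounded plurisubharmonic functions $u$ on $\Omega$ such that $u<0$, $\lim_{\zeta\to p}u(\zeta)=0$ for every $p\in\partial\Omega$, and $\int_\Omega(dd^cu)^n<\infty$ (extended by $0$ to $\partial\Omega$). *)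

(* Defs.v *)
From HB Require Import structures.
From mathcomp Require Import all_boot all_order all_algebra.
From mathcomp Require Import complex.
From mathcomp Require Import all_classical all_reals all_analysis.

Set Implicit Arguments.
Unset Strict Implicit.
Unset Printing Implicit Defensive.

Import Order.TTheory GRing.Theory Num.Theory.
Import numFieldNormedType.Exports.

Local Open Scope classical_set_scope.
Local Open Scope ring_scope.
Local Open Scope complex_scope.

(* The modulus topology on C, which the library only attaches to R[i]^o. *)
HB.instance Definition _ (R : rcfType) := NormedModule.copy R[i] R[i]^o.

(* C^n with its usual topology, and the same type with its Borel sigma-algebra. *)
Notation Cn R n := 'rV[R[i]]_n.
Notation borelCn R n := (g_sigma_algebraType (@open (Cn R n))).

Section Definitions.
Context {R : realType} {n : nat}.
Implicit Types (Omega X : set (Cn R n)) (z v : Cn R n).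

Definition eit (t : R) : R[i] := cos t +i* sin t.

(* Functions are total on C^n; only the values on Omega matter.  The value -oo
   is allowed, +oo is not. *)
Definition psh Omega (u : Cn R n -> \bar R) : Prop :=
  [/\ forall z, Omega z -> (u z < +oo)%E,
      forall z (a : \bar R), Omega z -> (u z < a)%E ->
        \forall w \near z, (u w < a)%E
    & forall z v,
        (forall c : R[i], `|c| <= 1 -> Omega (z + c *: v)) ->
        ((2 * pi)%:E * u z <=
          \int[lebesgue_measure]_(t in `[0%R, (2 * pi)%R])
            u (z + eit t *: v)%R)%E ].

(* No continuity is asked of the exhaustion phi: by Kerzman and Rosay a continuous
   one then exists as well. *)
Definition hyperconvex Omega : Prop :=
  [/\ open Omega, connected Omega, Omega !=set0, bounded_set Omega
    & exists phi : Cn R n -> R,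
      [/\ psh Omega (EFin \o phi),
          forall z, Omega z -> phi z < 0,
          exists M : R, forall z, Omega z -> `|phi z| <= M
        & forall c : R, c < 0 ->
            compact (closure [set z | Omega z /\ phi z < c]) /\
            closure [set z | Omega z /\ phi z < c] `<=` Omega ] ].

(* A positive Radon measure on X is represented by a Borel measure on C^n that
   is carried by X.  Inner and outer regularity are automatic for open or
   closed X. *)
Definition radon_on X (m : {measure set (borelCn R n) -> \bar R}) : Prop :=
  (forall K : set (Cn R n), compact K -> K `<=` X -> (m K < +oo)%E) /\
  m (~` X) = 0%E.

(* Values on boxes determine a Borel measure on C^n = R^(2n). *)
Definition is_lebesgue (m : {measure set (borelCn R n) -> \bar R}) : Prop :=
  forall a b : Cn R n,
    (forall j, complex.Re (a 0 j) <= complex.Re (b 0 j) /\ complex.Im (a 0 j) <= complex.Im (b 0 j)) ->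
    m [set z : Cn R n | forall j,
         (complex.Re (a 0 j) <= complex.Re (z 0 j) <= complex.Re (b 0 j)) /\
         (complex.Im (a 0 j) <= complex.Im (z 0 j) <= complex.Im (b 0 j))] =
    (\prod_j ((complex.Re (b 0 j) - complex.Re (a 0 j)) * (complex.Im (b 0 j) - complex.Im (a 0 j))))%:E.

(* R[i] carries no structure of normed space over R, hence the splitting into
   real and imaginary parts. *)
Definition rderiv (v : Cn R n) (f : Cn R n -> R[i]) (z : Cn R n) : R[i] :=
  derive1 (fun t : R => complex.Re (f (z + t%:C *: v))) 0 +i*
  derive1 (fun t : R => complex.Im (f (z + t%:C *: v))) 0.

Definition rderivable (v : Cn R n) (f : Cn R n -> R[i]) (z : Cn R n) : Prop :=
  derivable (fun t : R => complex.Re (f (z + t%:C *: v))) 0 1 /\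
  derivable (fun t : R => complex.Im (f (z + t%:C *: v))) 0 1.

Definition dz (j : 'I_n) (f : Cn R n -> R[i]) (z : Cn R n) : R[i] :=
  2^-1 * (rderiv (delta_mx 0 j) f z - 'i * rderiv ('i *: delta_mx 0 j) f z).

Definition dzbar (j : 'I_n) (f : Cn R n -> R[i]) (z : Cn R n) : R[i] :=
  2^-1 * (rderiv (delta_mx 0 j) f z + 'i * rderiv ('i *: delta_mx 0 j) f z).

Fixpoint Ck (k : nat) (f : Cn R n -> R[i]) : Prop :=
  continuous f /\
  match k with
  | 0%N => True
  | k'.+1 => forall v, (forall z, rderivable v f z) /\ Ck k' (rderiv v f)
  end.

(* phi stands for the (inhomogeneous) form
     sum_(I, J) phi I J dz_I /\ dzbar_J
   where dz_I = dz_i1 /\ ... /\ dz_ip for I = {i1 < ... < ip}. *)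
Definition dform := {set 'I_n} -> {set 'I_n} -> Cn R n -> R[i].

Definition test_form Omega (phi : dform) : Prop :=
  (forall I J k, Ck k (phi I J)) /\
  exists K : set (Cn R n), [/\ compact K, K `<=` Omega
    & forall I J z, ~ K z -> phi I J z = 0].

(* dz_i /\ dz_(I :\ i) = wsign i I * dz_I for i in I. *)
Definition wsign (i : 'I_n) (I : {set 'I_n}) : R[i] :=
  (-1) ^+ #|[set k in I | (k < i)%N]%SET|.

(* dd^c = 2 i d dbar, for d^c = i (dbar - d).  The factor (-1)^#|I :\ i| comes
   from moving dzbar_j past dz_(I :\ i). *)
Definition ddc (phi : dform) : dform := fun I J z =>
  \sum_(i in I) \sum_(j in J)
    2 * 'i * (-1) ^+ #|I :\ i| * wsign i I * wsign j J *
    dz i (dzbar j (phi (I :\ i) (J :\ j))) z.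

Definition cintegral (m : {measure set (borelCn R n) -> \bar R})
    (f : Cn R n -> R[i]) : R[i] :=
  (\int[m]_(z in setT) complex.Re (f z)) +i* (\int[m]_(z in setT) complex.Im (f z)).

(* A current of order zero, i.e. with measure coefficients, acting by
   phi |-> sum_(I, J) \int phi I J * cdens I J dcmass; it has bidegree (k, k)
   when it only sees the components with #|I| = #|J| = n - k. *)
Record current := Current {
  cmass : {measure set (borelCn R n) -> \bar R} ;
  cdens : {set 'I_n} -> {set 'I_n} -> Cn R n -> R[i] }.

Definition current_on Omega (T : current) : Prop :=
  [/\ radon_on Omega (cmass T),
      forall I J,
        measurable_fun setT (fun z : borelCn R n => complex.Re (cdens T I J z)) /\
        measurable_fun setT (fun z : borelCn R n => complex.Im (cdens T I J z))
    & exists C : R[i], forall I J z, `|cdens T I J z| <= C ].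

Definition ceval (T : current) (phi : dform) : R[i] :=
  \sum_(I : {set 'I_n}) \sum_(J : {set 'I_n})
    cintegral (cmass T) (fun z => phi I J z * cdens T I J z).

(* The current of integration over Omega, in terms of Lebesgue measure L:
   dz_1 /\ ... /\ dz_n /\ dzbar_1 /\ ... /\ dzbar_n
     = (-1)^(n(n-1)/2) (-2i)^n dL. *)
Definition integration_current Omega (T : current) : Prop :=
  (exists2 L : {measure set (borelCn R n) -> \bar R}, is_lebesgue L &
     forall A : set (borelCn R n), measurable A ->
       cmass T A = L (A `&` Omega)) /\
  (forall I J z, cdens T I J z =
     if (I == [set: 'I_n]%SET) && (J == [set: 'I_n]%SET)
     then (-1) ^+ 'C(n, 2) * (- (2 * 'i)) ^+ n else 0).

(* (dd^c u)^n = m in the sense of Bedford and Taylor, for u locally bounded and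
   plurisubharmonic on Omega: (dd^c u)^0 = 1 and
   (dd^c u)^(k+1) = dd^c (u (dd^c u)^k), each of these currents having measure
   coefficients. *)
Definition monge_ampere Omega (u : Cn R n -> R)
    (m : {measure set (borelCn R n) -> \bar R}) : Prop :=
  exists T : nat -> current,
  [/\ integration_current Omega (T 0%N),
      forall k, (k <= n)%N -> current_on Omega (T k),
      forall k phi, (k < n)%N -> test_form Omega phi ->
        ceval (T k.+1) phi =
        ceval (T k) (fun I J z => (u z)%:C * ddc phi I J z)
    & radon_on Omega m /\
      forall phi, test_form Omega phi ->
        ceval (T n) phi = cintegral m (phi finset.set0 finset.set0) ].

(* Members of Cegrell's class are extended by 0 outside Omega. *)
Definition cegrell_E0 Omega (u : Cn R n -> R) : Prop :=
  [/\ psh Omega (EFin \o u),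
      exists M : R, forall z, Omega z -> `|u z| <= M,
      forall z, Omega z -> u z < 0,
      (forall z, ~ Omega z -> u z = 0) /\
      (forall p, (closure Omega `\` Omega) p ->
         u z @[z --> within Omega (nbhs p)] --> (0 : R))
    & exists2 m : {measure set (borelCn R n) -> \bar R},
        monge_ampere Omega u m & (m Omega < +oo)%E ].

Definition psh_le Omega (nu mu : {measure set (borelCn R n) -> \bar R}) : Prop :=
  forall u, cegrell_E0 Omega u ->
    (\int[mu]_(z in closure Omega) (u z)%:E <=
     \int[nu]_(z in closure Omega) (u z)%:E)%E.

End Definitions.

(* Main.v *)
(* Restricting mu to a Borel set only increases the integrals of nonpositive
   functions, so every restriction of mu is a multiple k mu with k in [0, 1].
   Hence an open set of positive mass has a null complement, and compactness of
   the sublevel sets of the exhaustion gives, if mu <> 0, a point p all of whose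
   neighbourhoods have positive mass: mu is c times the Dirac mass at p, with
   0 < c < +oo.  By the sub-mean value inequality, c times the normalized
   arc-length measure of a small circle around p in a complex line is
   psh-below mu, but it does not charge p, so it is not a multiple of mu. *)

From HB Require Import structures.
Require Import Defs.
From mathcomp Require Import all_boot all_order all_algebra.
From mathcomp Require Import complex.
From mathcomp Require Import all_classical all_reals all_analysis.
From mathcomp Require Import measurable_realfun.

Set Implicit Arguments.
Unset Strict Implicit.
Unset Printing Implicit Defensive.

Import Order.TTheory GRing.Theory Num.Theory.
Import numFieldNormedType.Exports.
Local Open Scope classical_set_scope.
Local Open Scope ring_scope.

(** * Borel measurability in C^n *)

Lemma open_measurable_Cn (R : realType) (n : nat) (U : set (borelCn R n)) :
  open (U : set (Cn R n)) -> measurable U.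
Proof. by move=> oU; exact: sub_sigma_algebra. Qed.

Lemma closed_measurable_Cn (R : realType) (n : nat) (F : set (borelCn R n)) :
  closed (F : set (Cn R n)) -> measurable F.
Proof.
move=> cF; rewrite -(setCK F); apply: measurableC; apply: open_measurable_Cn.
exact: closed_openC.
Qed.

Lemma compact_measurable_Cn (R : realType) (n : nat) (K : set (borelCn R n)) :
  compact (K : set (Cn R n)) -> measurable K.
Proof. by move=> cK; apply: closed_measurable_Cn; exact: compact_closed. Qed.

Lemma set1_measurable_Cn (R : realType) (n : nat) (p : borelCn R n) :
  measurable [set p].
Proof. by apply: compact_measurable_Cn; exact: (@compact_set1 (Cn R n)). Qed.

Lemma continuous_measurable_Cn (R : realType) (n : nat) (f : R -> borelCn R n) :
  continuous (f : R -> Cn R n) -> measurable_fun setT f.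
Proof.
move=> cf.
apply: (@measurability _ _ R (borelCn R n) setT f (@open (Cn R n))) => //.
move=> _ [U oU <-].
rewrite setTI; apply: open_measurable.
by apply: (open_comp _ oU) => x _; exact: cf.
Qed.

(** * Continuity and modulus of the circle parametrization *)

Lemma eit_continuous (R : realType) : continuous (@eit R).
Proof.
move=> t; apply/cvgrPdist_lt => /= e e0.
(* The radius [e] lives in [R[i]], where [0 < e] means imaginary part zero and real part [a > 0]. *)
case: e e0 => a b; rewrite ltcE /= => /andP[/eqP -> a0] {b}.
have a20 : 0 < a / 2 by rewrite divr_gt0.
have /cvgrPdist_lt /(_ _ a20) Hc := @continuous_cos R t.
have /cvgrPdist_lt /(_ _ a20) Hs := @continuous_sin R t.
near=> s.
rewrite /eit.
have -> : (cos t +i* sin t - (cos s +i* sin s) =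
  (cos t - cos s) +i* (sin t - sin s))%C by [].
rewrite normc_def ltcE /= eqxx /=.
rewrite -[ltRHS]ger0_norm; last exact: ltW.
rewrite -sqrtr_sqr ltr_sqrt ?exprn_gt0//.
have hc : `|cos t - cos s| < a / 2 by near: s.
have hs : `|sin t - sin s| < a / 2 by near: s.
rewrite -(real_normK (num_real (cos t - cos s))).
rewrite -(real_normK (num_real (sin t - sin s))).
have hc0 := normr_ge0 (cos t - cos s).
have hs0 := normr_ge0 (sin t - sin s).
move: hc hs hc0 hs0; move: `|_| => x; move: `|_| => y hx hy x0 y0.
(* Expanding the square of this sum reduces the bound to [(a/2)^2 + (a/2)^2 <= a^2]. *)
have -> : a = a / 2 + a / 2 by rewrite -splitr.
rewrite sqrrD.
rewrite (@lt_le_trans _ _ ((a/2)^+2 + (a/2)^+2))//.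
  by apply: ltrD; rewrite ltr_pXn2r ?nnegrE// ltW.
by rewrite lerD2r lerDl mulrn_wge0// mulr_ge0// ltW.
Unshelve. all: by end_near. Qed.

Lemma circle_continuous (R : realType) (n : nat) (z v : Cn R n) :
  continuous (fun t : R => z + eit t *: v).
Proof.
move=> t; apply: cvgD; first exact: cvg_cst.
by apply: cvgZ; [exact: eit_continuous|exact: cvg_cst].
Qed.

Lemma norm_eit (R : realType) (t : R) : `|eit t| = 1.
Proof. by rewrite /eit normc_def /= cos2Dsin2 sqrtr1. Qed.

(** * Cegrell's class and the order on measures *)

Lemma cegrell_E0_le0 (R : realType) (n : nat) (Omega : set (Cn R n))
    (u : Cn R n -> R) : cegrell_E0 Omega u -> forall z, u z <= 0.
Proof.
case=> _ _ u0 [uout _] _ z; have [Oz|Oz] := pselect (Omega z).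
  exact/ltW/u0.
by rewrite uout.
Qed.

(** Inside [Omega] strict sublevel sets are open by upper semicontinuity. Outside, [u] is 0, so a
    level [a > 0] adds the whole complement of [Omega] and a level [a <= 0] adds nothing. *)
Lemma cegrell_E0_measurable (R : realType) (n : nat) (Omega : set (Cn R n))
    (u : borelCn R n -> R) : open Omega -> cegrell_E0 Omega u ->
  measurable_fun setT u.
Proof.
move=> oO [[_ usc _] _ u0 [uout _] _].
apply: (measurability _ (RGenInftyO.measurableE R)) => _ [_ [a ->] <-].
rewrite setTI.
have oA : open ([set z | Omega z /\ u z < a] : set (Cn R n)).
  rewrite openE => z [Oz uza].
  have Oz' : \forall w \near (z : Cn R n), Omega w by exact: open_nbhs_nbhs.
  have := usc z a%:E Oz; rewrite lte_fin => /(_ uza) uw.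
  apply: filterS2 Oz' uw => w Ow; rewrite lte_fin; by split.
have [a0|a0] := ltP 0 a.
  have -> : u @^-1` `]-oo, a[%classic =
     ([set z | Omega z /\ u z < a] : set (borelCn R n)) `|` ~` Omega.
    apply/seteqP; split => z /=; rewrite in_itv /=.
      by move=> uza; have [Oz|Oz] := pselect (Omega z); [left|right].
    by case=> [[]//|Oz]; rewrite uout.
  apply: measurableU; first exact: open_measurable_Cn.
  by apply: measurableC; exact: open_measurable_Cn.
have -> : u @^-1` `]-oo, a[%classic =
     ([set z | Omega z /\ u z < a] : set (borelCn R n)).
  apply/seteqP; split => z /=; rewrite in_itv /=; last by case.
  move=> uza; split=> //; apply: contrapT => Oz.
  by move: uza; rewrite uout// ltNge a0.
exact: open_measurable_Cn.
Qed.

(** Passing to [- u >= 0] gives access to integration of nonnegative functions, with no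
    integrability to check. *)
Lemma psh_le_intro (R : realType) (n : nat) (Omega : set (Cn R n))
    (nu mu : {measure set (borelCn R n) -> \bar R}) :
  (forall u, cegrell_E0 Omega u ->
     (\int[nu]_(z in closure Omega) (- u z)%:E <=
      \int[mu]_(z in closure Omega) (- u z)%:E)%E) ->
  psh_le Omega nu mu.
Proof.
move=> H u uE.
have E (m : {measure set (borelCn R n) -> \bar R}) :
   (\int[m]_(z in closure Omega) (u z)%:E =
    - \int[m]_(z in closure Omega) (- u z)%:E)%E.
  rewrite -integral_ge0N.
    by apply: eq_integral => z _; rewrite EFinN oppeK.
  by move=> z _; rewrite lee_fin oppr_ge0 (cegrell_E0_le0 uE).
by rewrite !E leeN2; exact: H.
Qed.

(** The restriction is dominated by [mu] on every Borel set, and [- u >= 0]. *)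
Lemma psh_le_mrestr (R : realType) (n : nat) (Omega : set (Cn R n))
    (mu : {measure set (borelCn R n) -> \bar R}) (A : set (borelCn R n))
    (mA : measurable A) :
  open Omega -> psh_le Omega (mrestr mu mA) mu.
Proof.
move=> oO; apply: psh_le_intro => u uE.
apply: ge0_le_measure_integral.
- move=> S mS; rewrite /mrestr/=; apply: le_measure; rewrite ?inE//.
  exact: measurableI.
- by apply: closed_measurable_Cn; exact: closed_closure.
- by move=> z; rewrite lee_fin oppr_ge0 (cegrell_E0_le0 uE).
- apply/measurable_EFinP; apply: measurable_funN.
  exact: cegrell_E0_measurable uE.
Qed.

(** * Concentration of a minimal measure at one point *)

Lemma hyperconvex_exhaustion (R : realType) (n : nat) (Omega : set (Cn R n)) :
  hyperconvex Omega ->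
  exists K : nat -> set (Cn R n),
    (forall m, compact (K m) /\ K m `<=` Omega) /\ Omega `<=` \bigcup_m K m.
Proof.
case=> _ _ _ _ [phi [_ phi0 _ cphi]].
(* The levels [- 1 / (m + 1)] increase to 0, so each point of [Omega], where [phi < 0], is
   eventually caught. *)
exists (fun m => closure [set z | Omega z /\ phi z < - m.+1%:R^-1]); split.
  by move=> m; apply: cphi; rewrite oppr_lt0 invr_gt0.
move=> z Oz; have [m] := ltr_add_invr (phi0 z Oz).
rewrite -ltrBrDr sub0r => hm; exists m => //; exact: subset_closure.
Qed.

(** Finitely many of the null open sets cover [K]. *)
Lemma compact_locally_null (R : realType) (n : nat)
    (mu : {measure set (borelCn R n) -> \bar R}) (K : set (Cn R n)) :
  compact K ->
  (forall p, K p -> exists U : set (Cn R n), [/\ open U, U p & mu U = 0%E]) ->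
  mu K = 0%E.
Proof.
move=> cK nullK.
have /choice[U UP] : forall p, exists U : set (Cn R n),
    K p -> [/\ open U, U p & mu U = 0%E].
  move=> p; have [Kp|nKp] := pselect (K p); last by exists set0.
  by have [U ?] := nullK p Kp; exists U.
apply: measure_negligible; first exact: compact_measurable_Cn.
move: (cK); rewrite compact_cover => /(_ (Cn R n) K U).
case.
- by move=> p /UP[].
- by move=> p Kp; exists p => //; case: (UP p Kp).
move=> D DK KD; apply: (@negligibleS _ (borelCn R n) _ mu _ _ KD).
rewrite /cover bigcup_fset big_seq; elim/big_rec : _ => [|p A pD A0].
  exact: negligible_set0.
apply: negligibleU => //; have := DK p pD; rewrite inE => /UP[oU _ U0].
by apply/negligibleP => //; exact: open_measurable_Cn.
Qed.

(** The complement of [p] is the countable union of the complements of the balls of radius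
    [1 / (m + 1)] around [p]. *)
Lemma measure_punctured_null (R : realType) (n : nat)
    (mu : {measure set (borelCn R n) -> \bar R}) (p : Cn R n) :
  (forall U : set (Cn R n), open U -> U p -> mu (~` U) = 0%E) ->
  mu (~` [set p]) = 0%E.
Proof.
move=> nullC; pose B m := ball p (m.+1%:R^-1 : R)%:C%C.
have B0 m : 0 < (m.+1%:R^-1 : R)%:C%C by rewrite ltcR invr_gt0.
have mp : measurable ([set p] : set (borelCn R n)).
  exact: set1_measurable_Cn.
apply: measure_negligible; first exact: measurableC.
apply: (@negligibleS _ (borelCn R n) _ mu (\bigcup_m ~` B m)); last first.
  apply: negligible_bigcup => m; apply/negligibleP.
    by apply: measurableC; apply: open_measurable_Cn; exact: ball_open.
  by apply: nullC; [exact: ball_open|exact: ballxx].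
move=> z /eqP zp.
have : 0 < `|p - z| by rewrite normr_gt0 subr_eq0 eq_sym.
(* The norm takes values in [R[i]]; being positive it is real, and the Archimedean property applies
   to its real part [a]. *)
move E : `|p - z| => [a b]; rewrite ltcE /= => /andP[/eqP b0 a0].
have [m hm] := ltr_add_invr a0; exists m => //.
rewrite /B -ball_normE /= E ltcE/= => /andP[_].
by apply/negP; rewrite -leNgt ltW// -[ltLHS]add0r.
Qed.

Lemma dirac_of_punctured_null d (T : measurableType d) (R : realType)
    (mu : {measure set T -> \bar R}) (p : T) : measurable [set p] ->
  mu (~` [set p]) = 0%E ->
  forall A, measurable A -> mu A = (mu [set p] * \d_p A)%E.
Proof.
move=> mp mu0 A mA.
have muD : mu (A `\` [set p]) = 0%E.
  apply: measure_negligible; first exact: measurableD.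
  apply: (@negligibleS _ _ _ _ (~` [set p])); first by move=> z [].
  by apply/negligibleP => //; exact: measurableC.
have -> : mu A = (mu (A `\` [set p]) + mu (A `&` [set p]))%E.
  exact: measureDI.
rewrite muD add0e diracE.
case: (boolP (p \in A)); rewrite ?inE ?notin_setE => pA.
  by rewrite mule1 setIidr// => _ ->.
by rewrite mule0 (_ : _ `&` _ = set0)// -subset0 => z [+ zp]; rewrite zp.
Qed.

Lemma minimal_measure_dirac (R : realType) (n : nat)
  (Omega : set (Cn R n)) (hOmega : hyperconvex Omega)
  (mu : {measure set (borelCn R n) -> \bar R}) (hmu : radon_on Omega mu)
  (hmin : forall (A : set (borelCn R n)) (mA : measurable A),
     exists2 k : R, 0 <= k <= 1 &
       forall B : set (borelCn R n), measurable B ->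
         mrestr mu mA B = (k%:E * mu B)%E) :
  mu Omega <> 0%E ->
  exists2 p, Omega p & mu (~` [set p]) = 0%E /\ (0 < mu [set p] < +oo)%E.
Proof.
move=> muO; have [oO _ _ _ _] := hOmega; have [fin_mu _] := hmu.
have [K [cK OK]] := hyperconvex_exhaustion hOmega.
have [m muK] : exists m, mu (K m) <> 0%E.
  apply: contrapT => /forallNP muK; apply: muO.
  apply: measure_negligible; first exact: open_measurable_Cn.
  apply: (@negligibleS _ (borelCn R n) _ mu _ _ OK).
  apply: negligible_bigcup => m.
  apply/negligibleP; last exact: contrapT (muK m).
  by apply: compact_measurable_Cn; case: (cK m).
have [cKm KO] := cK m.
(* A point of the support of [mu]: if [K m] contained none, it would be locally null. *)
have [p Kp chargep] : exists2 p, K m p &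
    forall U : set (Cn R n), open U -> U p -> mu U <> 0%E.
  apply: contrapT => H; apply: muK; apply: compact_locally_null => // p Kp.
  apply: contrapT => H'; apply: H; exists p => // U oU Up U0; apply: H'.
  by exists U.
exists p; first exact: KO.
have mup0 : mu (~` [set p]) = 0%E.
  apply: measure_punctured_null => U oU Up.
  have mU : measurable (U : set (borelCn R n)) by exact: open_measurable_Cn.
  have mCU : measurable (~` U : set (borelCn R n)) by exact: measurableC.
  have [k _ kE] := hmin _ mCU.
  (* On [U] the restriction to the complement vanishes, so [k * mu U = 0] and [k = 0]. On the
     complement the same identity then gives measure 0. *)
  have := kE _ mU; rewrite /mrestr setICr measure0 => /esym/eqP.
  rewrite mule_eq0 => /orP[|/eqP]; last by move/chargep: oU => /(_ Up).
  move=> /eqP k0; have := kE _ mCU; rewrite /mrestr setIid => ->.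
  by rewrite k0 mul0e.
split=> //; apply/andP; split; last first.
  apply: fin_mu; first exact: compact_set1.
  by move=> _ ->; exact: KO.
(* Without an atom at [p], [mu] would vanish on every Borel set, in particular on [K m]. *)
rewrite lt0e measure_ge0 andbT; apply/eqP => mup.
apply: muK; rewrite (dirac_of_punctured_null _ mup0) ?mup ?mul0e//.
  exact: set1_measurable_Cn.
exact: compact_measurable_Cn.
Qed.

(** * Discs in [Omega] and measures on their boundary circles *)

Lemma open_contains_disc (R : realType) (n : nat) (n_gt0 : (0 < n)%N)
    (Omega : set (Cn R n)) (p : Cn R n) : open Omega -> Omega p ->
  exists2 v : Cn R n, v != 0 &
    forall c : R[i], `|c| <= 1 -> Omega (p + c *: v).
Proof.
move=> oO Op.
have /nbhs_ballP[e /= e0 eO] : nbhs p Omega by exact: open_nbhs_nbhs.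
pose w : Cn R n := const_mx 1.
have w0 : w != 0.
  apply/eqP => /rowP /(_ (Ordinal n_gt0)); rewrite !mxE => /eqP.
  by rewrite oner_eq0.
(* Norm [e / 2] keeps the closed disc inside the open ball of radius [e]. *)
exists ((e / 2 / `|w|) *: w).
  rewrite scaler_eq0 (negbTE w0) orbF.
  by rewrite !mulf_neq0 ?invr_eq0 ?normr_eq0// gt_eqF.
move=> c c1; apply: eO; rewrite -ball_normE /= opprD addrA subrr sub0r normrN.
rewrite 2!normrZ.
have -> : `|e / 2 / `|w| | * `|w| = e / 2.
  rewrite ger0_norm ?divr_ge0// ?mulfVK ?normr_eq0//; exact: ltW.
rewrite (@le_lt_trans _ _ (e / 2))//.
  by rewrite ler_piMl// divr_ge0// ltW.
by rewrite ltr_pdivrMr// ltr_pMr// ltr1n.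
Qed.

Lemma two_pi_gt0 (R : realType) : 0 < 2 * pi :> R.
Proof. by rewrite mulr_gt0 ?pi_gt0. Qed.

Section circle_measure.
Context {R : realType} {n : nat}.

Definition circle (p v : Cn R n) (t : measurableTypeR R) : borelCn R n :=
  p + eit t *: v.

Lemma measurable_circle (p v : Cn R n) : measurable_fun setT (circle p v).
Proof. by apply: continuous_measurable_Cn; exact: circle_continuous. Qed.

HB.instance Definition _ (p v : Cn R n) :=
  isMeasurableFun.Build _ _ _ _ (circle p v) (measurable_circle p v).

(** For [v != 0], normalized arc length on the circle, scaled to total mass [c]. *)
Definition circle_measure (p v : Cn R n) (c : {nonneg R}) :
    {measure set (borelCn R n) -> \bar R} :=
  mscale c (distribution (uniform_prob (two_pi_gt0 R)) (circle p v)).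

Lemma circle_measureT (p v : Cn R n) (c : {nonneg R}) (A : set (borelCn R n)) :
  (forall t, A (circle p v t)) -> circle_measure p v c A = c%:num%:E.
Proof.
move=> At; rewrite /circle_measure/= /mscale/= /distribution /pushforward.
rewrite (_ : _ @^-1` A = setT) ?probability_setT ?mule1//.
by apply/seteqP; split=> t // _; exact: At.
Qed.

Lemma circle_measure0 (p v : Cn R n) (c : {nonneg R}) (A : set (borelCn R n)) :
  (forall t, ~ A (circle p v t)) -> circle_measure p v c A = 0%E.
Proof.
move=> At; rewrite /circle_measure/= /mscale/= /distribution /pushforward.
by rewrite (_ : _ @^-1` A = set0) ?measure0 ?mule0// -subset0 => t /At.
Qed.

(** Produces the angular integral that occurs in [psh]; the factor [(2 * pi)^-1] is the density of
    the uniform law. *)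
Lemma ge0_integral_circle (p v : Cn R n) (c : {nonneg R})
    (D : set (borelCn R n)) (f : borelCn R n -> \bar R) :
  measurable D -> (forall t, D (circle p v t)) ->
  measurable_fun setT f -> (forall z, 0 <= f z)%E ->
  (\int[circle_measure p v c]_(z in D) f z =
   c%:num%:E * ((2 * pi)^-1%:E *
     \int[lebesgue_measure]_(t in `[0%R, (2 * pi)%R]) f (p + eit t *: v)%R))%E.
Proof.
move=> mD Dt mf f0; rewrite ge0_integral_mscale//; last exact: measurable_funTS.
congr (_ * _)%E.
rewrite ge0_integral_pushforward//; last exact: measurable_funTS.
rewrite (_ : _ @^-1` D = setT); last by apply/seteqP; split=> t // _; exact: Dt.
rewrite integral_uniform ?subr0//.
- exact: measurableT_comp.
- by move=> t; exact: f0.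
Qed.

End circle_measure.

(** The sub-mean value inequality bounds the circle mean of [- u] by [- u p], its integral against
    the Dirac mass at [p]. *)
Lemma psh_le_circle (R : realType) (n : nat) (Omega : set (Cn R n))
    (mu : {measure set (borelCn R n) -> \bar R}) (p v : Cn R n)
    (c : {nonneg R}) :
  open Omega -> (forall a : R[i], `|a| <= 1 -> Omega (p + a *: v)) ->
  (forall A, measurable A -> mu A = (c%:num%:E * \d_(p : borelCn R n) A)%E) ->
  psh_le Omega (circle_measure p v c) mu.
Proof.
move=> oO disc muE; apply: psh_le_intro => u uE.
have clO z : Omega z -> closure Omega z by exact: subset_closure.
have Op : Omega p by have := disc 0; rewrite normr0 ler01 scale0r addr0; exact.
have mO : measurable (closure Omega : set (borelCn R n)).
  by apply: closed_measurable_Cn; exact: closed_closure.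
have mNu : measurable_fun setT (fun z : borelCn R n => (- u z)%:E).
  apply/measurable_EFinP; apply: measurable_funN.
  exact: cegrell_E0_measurable uE.
have u0 z : (0 <= (- u z)%:E)%E.
  by rewrite lee_fin oppr_ge0 (cegrell_E0_le0 uE).
rewrite ge0_integral_circle//; last first.
  by move=> t; apply: clO; apply: disc; rewrite norm_eit.
rewrite (@eq_measure_integral _ _ _ _ (mscale c (\d_(p : borelCn R n))));
  last first.
  by move=> A mA _; rewrite muE.
rewrite ge0_integral_mscale//; last exact: measurable_funTS.
rewrite integral_dirac//; last exact: measurable_funTS.
rewrite diracE mem_set ?mul1e; last exact: clO.
apply: lee_wpmul2l; first by rewrite lee_fin.
have [[_ _ submean] _ _ _ _] := uE.
have := submean p v disc.
(* Writing [u] as [- (- u)] lets the sign leave the integral of a nonnegative function and reverse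
   the inequality. *)
under eq_integral do rewrite /= -[u _]opprK EFinN.
rewrite integral_ge0N// leeNr => Hle.
rewrite lee_pdivrMl ?two_pi_gt0//; apply: (le_trans Hle).
by rewrite -muleN -EFinN.
Qed.

Theorem theorem5p6 (R : realType) (n : nat) (n_gt0 : (0 < n)%N)
  (Omega : set (Cn R n)) (hOmega : hyperconvex Omega)
  (mu : {measure set (borelCn R n) -> \bar R}) (hmu : radon_on Omega mu)
  (hmin : forall nu : {measure set (borelCn R n) -> \bar R},
     radon_on Omega nu -> psh_le Omega nu mu ->
     exists2 k : R, 0 <= k <= 1 &
       forall A : set (borelCn R n), measurable A -> nu A = (k%:E * mu A)%E) :
  mu Omega = 0%E.
Proof.
have [oO _ _ _ _] := hOmega; have [fin_mu muC] := hmu.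
apply: contrapT => muO.
have [|p Op [mup /andP[p0 poo]]] := minimal_measure_dirac hOmega hmu _ muO.
  move=> A mA; apply: hmin; last exact: psh_le_mrestr.
  (* Domination by [mu] passes on both finiteness on compact sets and nullity off [Omega]. *)
  split.
  - move=> K cK KO; apply: le_lt_trans (fin_mu K cK KO).
    have mK := compact_measurable_Cn cK.
    by rewrite /mrestr/=; apply: le_measure; rewrite ?inE//; exact: measurableI.
  - apply/eqP; rewrite -measure_le0 -muC; rewrite /mrestr/=.
    have mO : measurable (~` Omega : set (borelCn R n)).
      by apply: measurableC; exact: open_measurable_Cn.
    by apply: le_measure; rewrite ?inE//; exact: measurableI.
have [v v0 disc] := open_contains_disc n_gt0 oO Op.
(* The circle gets the mass of the atom; [fine] loses nothing because that mass is finite. *)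
have c0 : 0 <= fine (mu [set p]) by exact: fine_ge0.
pose c := NngNum c0.
have cE : mu [set p] = (c%:num%:E)%E by rewrite fineK// gt0_fin_numE.
have Ocirc t : Omega (circle p v t) by apply: disc; rewrite norm_eit.
have [||k _ kE] := hmin (circle_measure p v c).
- split=> [K cK _|]; last by apply: circle_measure0 => t; exact.
  apply: (@le_lt_trans _ _ (circle_measure p v c setT)).
    by apply: le_measure; rewrite ?inE//; exact: compact_measurable_Cn.
  by rewrite circle_measureT// ltry.
- apply: psh_le_circle => // A mA; rewrite -cE.
  by apply: dirac_of_punctured_null => //; exact: set1_measurable_Cn.
(* Off [p], the multiple of [mu] has mass 0, whereas the circle measure keeps its full mass
   [c > 0]. *)
have := kE _ (measurableC (set1_measurable_Cn p)).
rewrite mup mule0 circle_measureT.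
  by rewrite -cE => mup0; move: p0; rewrite mup0 ltxx.
(* Passing through [p] would force [eit t *: v = 0], although [eit t] has modulus 1 and [v != 0]. *)
move=> t /= /eqP; rewrite -subr_eq0 /circle addrC addKr scaler_eq0 (negbTE v0).
by rewrite orbF -normr_eq0 norm_eit oner_eq0.
Qed.
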